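(* Suppose the connectivity graph $\mathcal G_c=(\mathcal V,\mathcal E_c)$ on $N$ nodes is node-capacitated and Euclidean, with $C_{\mathrm{UP}}(i)\le\min\left(\frac{C_{\mathrm{DN}}(j)}{N},A(i',j')\right)$ for all $(i,j)\in\mathcal E_c$, and that the overlay is required to be undirected. Then the algorithm $\mathcal A$ described in the context is a $6$-approximation algorithm for the Minimal Cycle Time problem: the undirected overlay $\mathcal G_o$ it outputs satisfies $\tau(\mathcal G_o)\le 6\,\tau^*(\mathcal G_c)$, where $\tau^*(\mathcal G_c)$ is the minimum cycle time over all undirected overlays of $\mathcal G_c$.
   Context: Setting. The data are an integer $s\ge 1$, a model size $M>0$, uplink and downlink capacities $C_{\mathrm{UP}}(i),C_{\mathrm{DN}}(i)>0$, computation times $T_c(i)\ge 0$ ($i\in\mathcal V$), and for each $(i,j)\in\mathcal E_c$ a latency $l(i,j)\ge0$ and a core available bandwidth $A(i',j')>0$ (a number attached to the ordered pair $(i,j)$). Digraphs have no self-loops. Overlay and delays. An overlay is a strongly connected spanning subdigraph $\mathcal G_o=(\mathcal V,\mathcal E_o)$ of $\mathcal G_c$; it is undirected if $(i,j)\in\mathcal E_o\Rightarrow(j,i)\in\mathcal E_o$. With $\mathcal N_i^-$, $\mathcal N_i^+$ the out- and in-neighbours of $i$ in $\mathcal G_o$, the delays in a node-capacitated network (one where access link delays are not neglected) are $$d_o(i,j)=s\,T_c(i)+l(i,j)+\frac{M}{\min\left(\frac{C_{\mathrm{UP}}(i)}{|\mathcal N_i^-|},\frac{C_{\mathrm{DN}}(j)}{|\mathcal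 N_j^+|},A(i',j')\right)},\qquad (i,j)\in\mathcal E_o.$$ Cycle time. A circuit is a closed path $\gamma=(i_1,\dots,i_p=i_1)$, $p>1$, along arcs of $\mathcal G_o$; $|\gamma|$ is its number of arcs, $d_o(\gamma)=\sum_{k=1}^{p-1}d_o(i_k,i_{k+1})$, and $\tau(\mathcal G_o)=\max_\gamma d_o(\gamma)/|\gamma|$ over all circuits. The Minimal Cycle Time problem with undirected overlays asks for an undirected overlay of minimal cycle time. Euclidean. $\mathcal G_c$ is called Euclidean if it is complete and its delays $d_c(i,j)=s\,T_c(i)+l(i,j)+\frac{M}{A(i',j')}$ are symmetric, $d_c(i,j)=d_c(j,i)$ for all $i,j\in\mathcal V$, and satisfy the triangle inequality $d_c(i,j)\le d_c(i,k)+d_c(k,j)$ for all $i,j,k\in\mathcal V$. Algorithm $\mathcal A$. (1) Form the undirected graph $\mathcal G_c^{(u)}=(\mathcal V,\mathcal E_c^{(u)})$ with $(i,j)\in\mathcal E_c^{(u)}$ iff $(i,j),(j,i)\in\mathcal E_c$, with weights $$d_c^{(u)}(i,j)=\tfrac12\Big[s(T_c(i)+T_c(j))+l(i,j)+l(j,i)+\tfrac{M}{C_{\mathrm{UP}}(i)}+\tfrac{M}{C_{\mathrm{UP}}(j)}\Big].$$ (2) Compute a minimum weight spanning tree $\mathcal T$ of $\mathcal G_c^{(u)}$, its cube $\mathcal T^3$ (same vertices; $u,v$ adjacent iff joined in $\mathcal T$ by a path with at most three edges), and a Hamiltonian path $\mathcal H$ of $\mathcal T^3$ (the cube of a connected graph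 is known to have one, computable in polynomial time). Put $\mathbb S=\{\mathcal H\}$. (3) For each $\delta=3,4,\dots,N$, add to $\mathbb S$ the spanning tree of $\mathcal G_c^{(u)}$ produced by the degree-bounded Prim procedure: start from an arbitrary vertex and repeatedly add the smallest-weight edge $(u,v)$ with $u$ in the current tree, $v$ not in it, and the current tree-degree of $u$ less than $\delta$, until the tree spans. (4) Output an element of $\mathbb S$, viewed as an undirected overlay (both orientations of each edge), with minimum cycle time $\tau$. *)

(* Defs.v *)
From HB Require Import structures.
From mathcomp Require Import all_boot all_order all_algebra.
From mathcomp Require Import classical_sets reals.

Set Implicit Arguments.
Unset Strict Implicit.
Unset Printing Implicit Defensive.

Import Order.TTheory GRing.Theory Num.Theory.
Local Open Scope ring_scope.

(* A digraph on the vertex type V is its set of arcs; an undirected graph is a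
   symmetric set of arcs (both orientations of each edge). *)

(* [lat] and [bw] are total functions, but their values are constrained and used
   on arcs of the connectivity graph only; [bw i j] is the number A(i',j')
   attached to the ordered pair (i,j). *)
Record network (R : realType) (V : finType) := Network {
  conn : {set V * V};
  nsteps : nat;
  msize : R;
  cup : V -> R;
  cdn : V -> R;
  tcomp : V -> R;
  lat : V -> V -> R;
  bw : V -> V -> R;
  conn_irr : forall i, (i, i) \notin conn;
  nsteps_gt0 : (0 < nsteps)%N;
  msize_gt0 : 0 < msize;
  cup_gt0 : forall i, 0 < cup i;
  cdn_gt0 : forall i, 0 < cdn i;
  tcomp_ge0 : forall i, 0 <= tcomp i;
  lat_ge0 : forall i j, (i, j) \in conn -> 0 <= lat i j;
  bw_gt0 : forall i j, (i, j) \in conn -> 0 < bw i j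
}.

Section Digraphs.
Variable V : finType.
Implicit Types (E T : {set V * V}) (c h : seq V).

Definition arc_rel E : rel V := fun i j => (i, j) \in E.

Definition outdeg E i : nat := #|[set j | (i, j) \in E]|.
Definition indeg E j : nat := #|[set i | (i, j) \in E]|.

Definition strongly_connected E : Prop := forall i j, connect (arc_rel E) i j.

Definition undirected E : Prop := forall i j, (i, j) \in E -> (j, i) \in E.

(* The closed path (i_1, ..., i_p = i_1), p > 1, is represented by
   c = [:: i_1; ...; i_(p-1)]; vertices may be repeated. *)
Definition circuit E c : bool := (c != [::]) && cycle (arc_rel E) c.

(* No loops are considered here: this is only used for subgraphs of a loopless
   graph.  Cycles of size 2 are the two orientations of a single edge. *)
Definition acyclic T : Prop :=
  forall c, (2 < size c)%N -> uniq c -> ~~ cycle (arc_rel T) c.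

Definition spanning_tree E T : Prop :=
  [/\ T \subset E, undirected T, strongly_connected T & acyclic T].

Definition cube T : {set V * V} :=
  [set e | (e.1 != e.2) &&
           [exists p : {bseq 3 of V}, path (arc_rel T) e.1 p && (last e.1 p == e.2)]].

Definition hamiltonian_path E h : Prop :=
  [/\ uniq h, forall v, v \in h & sorted (arc_rel E) h].

Definition path_graph h : {set V * V} :=
  [set e | (e \in zip h (behead h)) || ((e.2, e.1) \in zip h (behead h))].

End Digraphs.

Section CycleTime.
Variables (R : realType) (V : finType) (net : network R V).
Implicit Types (E T : {set V * V}) (c : seq V).

Definition conn_delay (i j : V) : R :=
  (nsteps net)%:R * tcomp net i + lat net i j + msize net / bw net i j.

Definition overlay_delay E (i j : V) : R :=
  (nsteps net)%:R * tcomp net i + lat net i j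
  + msize net / Num.min (cup net i / (outdeg E i)%:R)
                        (Num.min (cdn net j / (indeg E j)%:R) (bw net i j)).

Definition undirected_overlay E : Prop :=
  [/\ E \subset conn net, strongly_connected E & undirected E].

Definition circuit_delay E c : R :=
  \sum_(e <- zip c (rot 1 c)) overlay_delay E e.1 e.2.

(* If E has a circuit, the supremum is a maximum: the means are bounded by the largest arc delay, and
   every circuit decomposes into the finitely many elementary ones. *)
Definition cycle_time E : R :=
  sup [set circuit_delay E c / (size c)%:R | c in [set c | circuit E c]]%classic.

(* A minimum: there are finitely many overlays (at least one if the network is
   complete). *)
Definition opt_cycle_time : R :=
  inf [set cycle_time E | E in [set E | undirected_overlay E]]%classic.

(* Delays are attached to arcs only, so the triangle inequality is required for
   pairwise distinct nodes. *)
Definition euclidean : Prop :=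
  [/\ forall i j, i != j -> (i, j) \in conn net,
      forall i j, i != j -> conn_delay i j = conn_delay j i
    & forall i j k, i != j -> i != k -> k != j ->
        conn_delay i j <= conn_delay i k + conn_delay k j].

Definition sym_conn : {set V * V} :=
  [set e | (e \in conn net) && ((e.2, e.1) \in conn net)].

Definition und_weight (i j : V) : R :=
  2^-1 * ((nsteps net)%:R * (tcomp net i + tcomp net j) + lat net i j + lat net j i
          + msize net / cup net i + msize net / cup net j).

(* Each edge occurs in T with both orientations, hence the division by 2. *)
Definition tree_weight T : R := (\sum_(e in T) und_weight e.1 e.2) / 2.

Definition minimum_spanning_tree T : Prop :=
  spanning_tree sym_conn T /\
  forall T', spanning_tree sym_conn T' -> tree_weight T <= tree_weight T'.

Definition prim_candidate (delta : nat) (U : {set V}) T (u v : V) : bool :=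
  [&& (u, v) \in sym_conn, u \in U, v \notin U & (outdeg T u < delta)%N].

(* [prim_run delta U T]: the degree-bounded Prim procedure can reach the tree
   with vertex set U and edge set T. *)
Inductive prim_run (delta : nat) : {set V} -> {set V * V} -> Prop :=
| prim_start (v : V) : prim_run delta [set v] finset.set0
| prim_step (U : {set V}) T (u v : V) :
    prim_run delta U T ->
    prim_candidate delta U T u v ->
    (forall u' v', prim_candidate delta U T u' v' ->
                   und_weight u v <= und_weight u' v') ->
    prim_run delta (v |: U) ((u, v) |: ((v, u) |: T)).

(* All the choices left open by the algorithm (minimum spanning tree,
   Hamiltonian path, starting vertices, ties) are nondeterministic. *)
Definition algorithm_output E : Prop :=
  exists (T : {set V * V}) (h : seq V) (P : nat -> {set V * V}),
    [/\ minimum_spanning_tree T,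
        hamiltonian_path (cube T) h,
        forall delta, (3 <= delta <= #|V|)%N -> prim_run delta [set: V] (P delta)
      & let S := path_graph h :: [seq P delta | delta <- index_iota 3 #|V|.+1] in
        E \in S /\ forall E', E' \in S -> cycle_time E <= cycle_time E'].

End CycleTime.

(* Main.v *)
Require Import Defs.
From HB Require Import structures.
From mathcomp Require Import all_boot all_order all_algebra.
From mathcomp Require Import classical_sets reals boolp.
From mathcomp Require Import ring lra.

Import Order.TTheory GRing.Theory Num.Theory.
Local Open Scope ring_scope.

(** Since every uplink is a bottleneck, an arc (i, j) of an overlay has delay
    s T_c(i) + l(i,j) + deg(i) M / C_UP(i).  The 2-circuits of an undirected overlay
    thus bound its cycle time from below by the weight of each of its edges, hence,
    by the bottleneck property of minimum spanning trees, by the weight of each edge of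
    the tree T: call B this lower bound.  On a path all circuits traverse each edge
    equally often in both directions, so that the cycle time of H is the largest mean
    delay of an edge.  As H has degree at most 2, an edge (u, v) of H has mean delay at
    most d_c(u,v) + M / C_UP(u) + M / C_UP(v), where d_c(u,v) is at most the sum of d_c
    along a path of at most three edges of T.  Each of these edges has d_c <= B,
    and d_c + M / C_UP(x) <= 2 B for both of its ends x; hence the total is at most
    2 B + B + 2 B = 5 B. *)

(** * Cuts, spanning trees and the exchange of tree edges *)

Section Graphs.
Variable V : finType.
Implicit Types (E F T : {set V * V}) (U : {set V}) (c h s : seq V).

Lemma connect_forward (e : rel V) (U : {pred V}) x y :
  (forall u v, u \in U -> e u v -> v \in U) ->
  connect e x y -> x \in U -> y \in U.
Proof.
move=> Ucl /connectP [p + ->]; elim: p x => //= z p IHp x /andP [exz ep] Ux.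
exact: IHp (Ucl _ _ Ux exz).
Qed.

Lemma connect_crossing (e : rel V) U x y :
  connect e x y -> x \in U -> y \notin U ->
  exists u v, [/\ u \in U, v \notin U & e u v].
Proof.
move=> exy xU; apply: contraNP => noUV; apply: connect_forward exy xU => u v uU euv.
by apply: contra_notT noUV => vU; exists u, v.
Qed.

Lemma undirected_connect_sym E : undirected E -> connect_sym (arc_rel E).
Proof.
move=> symE; apply: symmetric_from_pre => x y.
case/connectP => p Ep ->; elim: p x Ep => //= z p IHp x /andP [/symE zx /IHp].
by move/connect_trans; apply; apply: connect1.
Qed.

Lemma next_neq_prev {c x} : uniq c -> (2 < size c)%N -> x \in c ->
  next c x != prev c x.
Proof.
move=> Uc c2 xc; have [i p def_c] := rot_to xc.
rewrite -(next_rot i) // -(prev_rot i) // def_c.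
move: Uc c2; rewrite -(rot_uniq i) -(size_rot i) def_c.
rewrite next_nth prev_nth mem_head /= eqxx /= => /andP [xp Up] p1.
rewrite memNindex // -last_nth; case: p {def_c xp} Up p1 => [|y p] //= /andP [yp _].
by case: p yp => // z p yp _; apply: contraNneq yp => {1}->; apply: (mem_last z).
Qed.

(* A closed walk crossing a cut through a single edge must come back through
   the same edge, in the other direction. *)
Lemma cycle_bridge E U a b c :
  uniq c -> (2 < size c)%N -> cycle (arc_rel E) c ->
  a \notin U -> b \in U ->
  (forall u v, (u, v) \in E -> u \in U -> v \notin U -> u = b /\ v = a) ->
  a \in c -> next c a != b.
Proof.
move=> Uc c2 Ec aU bU cut ac; apply/eqP => nab.
have bc : b \in c by rewrite -nab mem_next.
have cba : fconnect (next c) b a.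
  by rewrite (fconnect_cycle (cycle_next Uc)) .
have [u [v [/setIP [uU uc] vU /eqP nuv]]] :
  exists u v, [/\ u \in U :&: [set x in c], v \notin U :&: [set x in c] & frel (next c) u v].
  by apply: connect_crossing cba _ _; rewrite !inE ?bU // (negPf aU).
rewrite inE in uc; rewrite !inE -nuv mem_next uc andbT nuv in vU.
have [eub eva] : u = b /\ v = a.
  by apply: cut uU vU; rewrite -nuv; apply: next_cycle Ec uc.
have := next_neq_prev Uc c2 bc; rewrite -{2}nab prev_next // -eub -eva nuv eqxx.
by [].
Qed.

(** Provides a spanning tree to minimize from. A cycle of length over 2 in the star would pass
    through a leaf, whose two distinct neighbours on the cycle would both be the centre. *)
Lemma star_spanning_tree E : undirected E ->
  (exists r, forall x, x != r -> (r, x) \in E) \/ #|V| = 0%N ->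
  exists T, spanning_tree E T.
Proof.
move=> symE [[r Er]|V0]; last first.
  have noV (i : V) : False by have := fintype0 i V0.
  exists finset.set0; split; first exact: finset.sub0set.
  - by move=> i j; rewrite inE.
  - by move=> i; case: (noV i).
  - by case=> [|i c] //; case: (noV i).
(* The star centred at [r]; the exclusive or rules out the loop at [r]. *)
pose T := [set e : V * V | (e.1 == r) (+) (e.2 == r)].
have symT : undirected T by move=> i j; rewrite !inE /= addbC.
exists T; split=> //.
- apply/fintype.subsetP => -[x y]; rewrite inE /=.
  case: eqP => [->|/eqP xr] /=; first by move=> yr; apply: Er; rewrite yr.
  by move/eqP->; apply: symE; apply: Er.
- suff rx x : connect (arc_rel T) r x.
    by move=> x y; apply: connect_trans (rx y); rewrite undirected_connect_sym.
  have [-> //|xr] := eqVneq x r; apply: connect1.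
  by rewrite /arc_rel inE /= eqxx (negPf xr).
- move=> c c2 Uc; apply/negP => Tc.
  have [x xc xr] : exists2 x, x \in c & x != r.
    case: c c2 Uc {Tc} => [|x [|y c]] //= _ /andP [xyc _].
    have [xr|] := eqVneq x r; last by exists x; rewrite ?mem_head.
    exists y; first by rewrite !inE eqxx orbT.
    by apply: contraNneq xyc => ->; rewrite xr mem_head.
  have := next_neq_prev Uc c2 xc.
  have := next_cycle Tc xc; have := prev_cycle Tc xc.
  by rewrite /arc_rel !inE /= (negPf xr) addbF => /eqP-> /eqP->; rewrite eqxx.
Qed.

Definition del_edge T i j := T :\: [set (i, j); (j, i)].

Lemma del_edge_sym T i j : undirected T -> undirected (del_edge T i j).
Proof.
move=> symT x y; rewrite !inE !xpair_eqE => /andP [+ /symT ->]; rewrite andbT.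
by rewrite orbC ![(y == _) && _]andbC.
Qed.

(** A simple path from [i] to [j] that avoids the edge has at least two arcs, so the arc from [j] to
    [i] would close it to a cycle of [T]. *)
Lemma acyclic_del_edge T i j : undirected T -> acyclic T -> i != j ->
  (i, j) \in T -> ~~ connect (arc_rel (del_edge T i j)) i j.
Proof.
move=> symT acT ij Tij; apply/negP => /connectP [p].
case/shortenP => q Fq Uq _ jq.
have Tq : path (arc_rel T) i q.
  by apply: sub_path Fq => u v; rewrite /arc_rel inE => /andP [].
have: cycle (arc_rel T) (i :: q) by rewrite /= rcons_path Tq -jq; apply: symT.
apply/negP/acT => //=.
case: q {Uq Tq} Fq jq => [|x [|y q]] //=; first by move=> _ ji; rewrite ji eqxx in ij.
by rewrite andbT => + jx; rewrite -jx /arc_rel !inE eqxx.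
Qed.

(** Deleting the edge splits [T] into the sides of [i] and [j], and the new edge rejoins them. Being
    a bridge, it lies on no cycle, so a cycle of the new graph would already be one of [T]. *)
Lemma exchange_spanning_tree E T i j a b :
  undirected E -> spanning_tree E T -> i != j -> (i, j) \in T -> (a, b) \in E ->
  let F := del_edge T i j in
  connect (arc_rel F) i a -> ~~ connect (arc_rel F) i b ->
  spanning_tree E ((a, b) |: ((b, a) |: F)).
Proof.
move=> symE [TE symT conT acT] ij Tij Eab F ia ib.
have symF : undirected F by exact: del_edge_sym.
set T' := _ |: _.
have symT' : undirected T'.
  move=> x y; rewrite 2!in_setU1 !xpair_eqE => /or3P [/andP[/eqP-> /eqP->]|/andP[/eqP-> /eqP->]|Fxy].
  - by rewrite !inE eqxx orbT.
  - by rewrite !inE eqxx.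
  - by rewrite !in_setU1 symF ?orbT.
have FT' x y : connect (arc_rel F) x y -> connect (arc_rel T') x y.
  by apply: connect_sub => u v Fuv; apply: connect1; rewrite /arc_rel !in_setU1 [_ \in F]Fuv !orbT.
(* The union of the two sides is closed under the arcs of [T]: the deleted arcs end in [i] or
   [j]. *)
have iVj x : connect (arc_rel F) i x || connect (arc_rel F) j x.
  apply: (@connect_forward (arc_rel T)
    [pred x | connect (arc_rel F) i x || connect (arc_rel F) j x] i x _ (conT i x)); last first.
    by rewrite inE connect0.
  move=> u v; rewrite !inE => uF Tuv.
  have [Fuv|] := boolP ((u, v) \in F).
    by case/orP: uF => uF; apply/orP; [left|right]; apply: connect_trans uF (connect1 _).
  rewrite inE [_ \in T]Tuv andbT negbK !inE !xpair_eqE.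
  by case/orP => /andP [_ /eqP ->]; rewrite connect0 ?orbT.
have jb : connect (arc_rel F) j b by have := iVj b; rewrite (negPf ib).
have Tab : connect (arc_rel T') a b by apply: connect1; rewrite /arc_rel !inE eqxx.
split=> //.
- apply/fintype.subsetP => e; rewrite !in_setU1 => /or3P [/eqP->|/eqP->|] //; first exact: symE.
  by rewrite inE => /andP [_ /(fintype.subsetP TE)].
- have iT' x : connect (arc_rel T') i x.
    case/orP: (iVj x) => [/FT' //|jx].
    apply: connect_trans (connect_trans (FT' _ _ ia) Tab) _.
    by apply: connect_trans (FT' _ _ jx); rewrite undirected_connect_sym //; apply: FT'.
  by move=> x y; apply: connect_trans (iT' y); rewrite undirected_connect_sym.
- move=> c c2 Uc; apply/negP => Tc.
  pose U := [set x | connect (arc_rel F) i x].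
  have cut x y : (x, y) \in T' -> x \in U -> y \notin U -> x = a /\ y = b.
    rewrite !in_setU1 => + xU yU => /or3P [/eqP[-> ->] //|/eqP[xb _]|Fxy].
      by move: xU; rewrite xb inE (negPf ib).
    by case/negP: yU; move: xU; rewrite !inE => xU; apply: connect_trans xU (connect1 _).
  have cut' x y : (x, y) \in T' -> x \in ~: U -> y \notin ~: U -> x = b /\ y = a.
    by rewrite !finset.in_setC negbK => /symT' Tyx xU yU; have [-> ->] := cut _ _ Tyx yU xU.
  have [] := boolP (cycle (arc_rel T) c); first by apply/negP/acT.
  (* [cycle_bridge], applied to [U] and to its complement, excludes both orientations of the new
     edge. *)
  case/negP; have Enext x : x \in c -> (x, next c x) \in F.
    move=> xc; have := next_cycle Tc xc; rewrite /arc_rel !in_setU1.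
    case/or3P => [/eqP[xa nb]|/eqP[xb na]|//].
    - have := @cycle_bridge T' (~: U) a b c Uc c2 Tc.
      by rewrite !inE ia ib => /(_ isT isT cut'); rewrite -xa nb xa eqxx -xa => /(_ xc).
    - have := @cycle_bridge T' U b a c Uc c2 Tc.
      by rewrite !inE ia ib => /(_ isT isT cut); rewrite -xb na xb eqxx -xb => /(_ xc).
  by apply: cycle_from_next => // x /Enext; rewrite inE => /andP [].
Qed.
End Graphs.

(** * Hamiltonian paths in the cube of a connected graph *)

Section CubePath.
Variables (V : finType) (e : rel V).
Implicit Types (X Y : {set V}) (h : seq V).

Definition eq_or_adj : rel V := fun x y => (x == y) || e x y.

(** Reflexive, unlike adjacency in the cube: this treats walks of zero to three arcs uniformly, and
    the distinctness of consecutive vertices comes from the uniqueness of the path. *)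
Definition within3 : rel V := fun x y =>
  [exists z, exists w, [&& eq_or_adj x z, eq_or_adj z w & eq_or_adj w y]].

(** For [r] in [X] and symmetric [e], the connected component of [r] in the subgraph induced on
    [X]. *)
Definition reach_in X r : {set V} :=
  [set x | connect [rel x y | e x y && (y \in X)] r x].

Lemma reach_in_step X r u v :
  u \in reach_in X r -> e u v -> v \in X -> v \in reach_in X r.
Proof.
rewrite !inE => ru uv vX; apply: connect_trans ru (connect1 _).
by rewrite /= uv.
Qed.

Lemma reach_in_min X r (U : {pred V}) :
  r \in U -> (forall u v, u \in U -> e u v -> v \in X -> v \in U) ->
  {subset reach_in X r <= U}.
Proof.
move=> rU Ucl x; rewrite inE => rx; apply: connect_forward rx rU => u v uU /andP [].
exact: Ucl.
Qed.

Lemma reach_in_sub {X r} : r \in X -> {subset reach_in X r <= X}.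
Proof. by move=> rX; apply: reach_in_min. Qed.

Lemma reach_in_mono X Y r : {subset X <= Y} -> {subset reach_in X r <= reach_in Y r}.
Proof.
move=> XY; apply: reach_in_min => [|u v uY uv /XY vY]; first by rewrite inE connect0.
exact: reach_in_step uY uv vY.
Qed.

(* The path is required to end next to its start so that the paths of the two
   sides of an edge (r, c) can be glued: the end r' of the first one and the end c'
   of the second one are at distance at most three via r' - r - c - c'. *)
Lemma within3_path {X r} : symmetric e -> r \in X ->
  exists h, [/\ uniq (r :: h), r :: h =i reach_in X r, path within3 r h
              & eq_or_adj r (last r h)].
Proof.
move=> sym_e; have [n] := ubnP #|X|; elim: n X r => // n IHn X r Xn rX.
have [noc|] := boolP [forall c, ~~ [&& c \in X, c != r & e r c]].
  exists [::]; split=> //; last by rewrite /eq_or_adj eqxx.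
  move=> x; rewrite inE; apply/eqP/idP => [->|]; first by rewrite inE connect0.
  move=> /(@reach_in_min X r (pred1 r)) H; apply/eqP; apply: H; first by rewrite inE.
  move=> u v /eqP-> rv vX; have := forallP noc v; rewrite vX rv andbT /= negbK.
  by [].
rewrite negb_forall => /existsP [c]; rewrite negbK => /and3P [cX cr rc].
(* [B] is the component of the neighbour [c] once [r] is removed, [A] that of [r] once [B] is
   removed. Both are smaller than the bound for [X] allows; the path of [A] is followed by the
   reversed path of [B], which ends at [c], next to [r]. *)
pose B := reach_in (X :\ r) c; pose A := reach_in (X :\: B) r.
have cXr : c \in X :\ r by rewrite !inE cr.
have cB : c \in B by rewrite inE connect0.
have rB : r \notin B by apply/negP => /(reach_in_sub cXr); rewrite !inE eqxx.
have [pB [UB BE PB LB]] : exists h, [/\ uniq (c :: h), c :: h =i B, path within3 c h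
              & eq_or_adj c (last c h)].
  by apply: IHn cXr; rewrite -ltnS; apply: leq_trans Xn; rewrite ltnS; apply/proper_card/properD1.
have rXB : r \in X :\: B by rewrite inE rB.
have [pA [UA AE PA LA]] : exists h, [/\ uniq (r :: h), r :: h =i A, path within3 r h
              & eq_or_adj r (last r h)].
  apply: IHn rXB; apply: leq_trans (_ : #|X| <= n)%N => //; apply: proper_card.
  rewrite properE finset.subsetDl; apply/subsetPn; exists c => //.
  by rewrite inE cB.
have symw : symmetric within3.
  have symea : symmetric eq_or_adj by move=> x y; rewrite /eq_or_adj eq_sym sym_e.
  move=> x y; apply/existsP/existsP => -[z /existsP [w /and3P [h1 h2 h3]]];
    exists w; apply/existsP; exists z;
    by rewrite [eq_or_adj _ w]symea h3 [eq_or_adj w z]symea h2 symea h1.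
have revB : rev (c :: pB) = last c pB :: rev (belast c pB).
  by rewrite lastI rev_rcons.
exists (pA ++ rev (c :: pB)); split.
- rewrite -cat_cons cat_uniq rev_uniq UA UB andbT /=; apply/hasPn => x.
  rewrite mem_rev BE => xB; rewrite [_ \in _]AE; apply/negP => /(reach_in_sub rXB).
  by rewrite inE xB.
- move=> x; rewrite -cat_cons mem_cat mem_rev AE BE; apply/orP/idP.
    case=> [|xB]; first by apply: reach_in_mono => y; rewrite inE => /andP [].
    apply: reach_in_min xB; first by apply: reach_in_step cX; rewrite ?inE ?connect0.
    by move=> u v uR uv; rewrite inE => /andP [_]; apply: reach_in_step uv.
  move=> xR; apply/orP; move: x xR; apply: (@reach_in_min X r [predU A & B]).
    by rewrite inE /= [r \in A]inE connect0.
  move=> u v /orP uAB uv vX; apply/orP.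
  have [vB|vB] := boolP (v \in B); [by right|left].
  case: uAB => [uA|uB]; first by apply: reach_in_step uA uv _; rewrite inE vB.
  (* [B] absorbs all its neighbours in [X] except [r], so an arc leaving [B] within [X] ends in
     [r]. *)
  have [->|vr] := eqVneq v r; first by rewrite inE connect0.
  by case/negP: vB; apply: reach_in_step uB uv _; rewrite !inE vr.
- rewrite cat_path PA revB /=; apply/andP; split.
    apply/existsP; exists r; apply/existsP; exists c.
    have -> : eq_or_adj (last r pA) r by rewrite /eq_or_adj eq_sym sym_e.
    by rewrite LB /eq_or_adj rc orbT.
  have := rev_path within3 c pB; rewrite (eq_path (e' := within3)) ?PB //.
- by rewrite last_cat revB /= -[last _ _]/(last c (last c pB :: rev (belast c pB))) -revB rev_cons last_rcons
    /eq_or_adj rc orbT.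
Qed.
End CubePath.

Lemma cube_hamiltonian_path (V : finType) (T : {set V * V}) :
  undirected T -> strongly_connected T -> exists h, hamiltonian_path (cube T) h.
Proof.
move=> symT conT; have symr : symmetric (arc_rel T) by apply: symmetric_from_pre.
have [r _|V0] := pickP [pred x : V | true]; last first.
  by exists [::]; split=> // v; have := V0 v.
have [h [Uh hE Ph _]] := @within3_path V (arc_rel T) [set: V] r symr (finset.in_setT r).
exists (r :: h); split=> // [v|].
  rewrite hE inE; apply: connect_sub (conT r v) => x y xy; apply: connect1.
  by rewrite /= inE andbT.
have sub3 : subrel (within3 _ (arc_rel T))
    (fun x y => (x == y) || arc_rel (cube T) x y).
  move=> x y /existsP [z /existsP [w /and3P [xz zw wy]]]; rewrite /arc_rel inE /=.
  case: eqP => //= /eqP xy.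
  pose stp a b : seq V := if a == b then [::] else [:: b].
  have stpP a b : eq_or_adj _ (arc_rel T) a b -> path (arc_rel T) a (stp a b).
    by rewrite /stp /eq_or_adj; case: eqP => //= _ ->.
  have stpL a b : last a (stp a b) = b by rewrite /stp; case: eqP.
  have sz : (size (stp x z ++ stp z w ++ stp w y) <= 3)%N.
    by rewrite !size_cat /stp; do 3 case: eqP => _.
  apply/existsP; exists (Bseq sz); rewrite /= !cat_path !last_cat !stpL eqxx.
  by rewrite !stpP.
have Sw : sorted (within3 _ (arc_rel T)) (r :: h) by [].
have /(sortedP r) S := sub_sorted sub3 Sw.
apply/(sortedP r) => i ih.
(* Uniqueness discards the equality alternative of [sub3]. *)
have := S i ih; rewrite nth_uniq //; last by apply: ltnW.
by rewrite ltn_eqF.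
Qed.

(** * The undirected graph of a path: degrees and potentials *)

Section PathGraph.
Variables (V : finType) (x0 : V).
Implicit Types (E : {set V * V}) (h : seq V).

Lemma path_graphP h x y :
  reflect (exists2 k, (k.+1 < size h)%N &
             (x = nth x0 h k /\ y = nth x0 h k.+1) \/
             (y = nth x0 h k /\ x = nth x0 h k.+1))
          ((x, y) \in path_graph h).
Proof.
have zipP a b : reflect (exists2 k, (k.+1 < size h)%N & a = nth x0 h k /\ b = nth x0 h k.+1)
    ((a, b) \in zip h (behead h)).
  have sz : size (zip h (behead h)) = (size h).-1.
    by rewrite size_zip size_behead; apply/minn_idPr/leq_pred.
  have nz k : (k < (size h).-1)%N ->
    nth (x0, x0) (zip h (behead h)) k = (nth x0 h k, nth x0 h k.+1).
    by move=> kh; rewrite nth_zip_cond sz kh nth_behead.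
  apply: (iffP (nthP (x0, x0))) => [[k]|[k kh [-> ->]]].
    by rewrite sz => kh; rewrite nz // => -[<- <-]; exists k => //; case: (size h) kh.
  by exists k; rewrite ?nz ?sz //; case: (size h) kh.
rewrite inE /=; apply: (iffP orP) => [[/zipP|/zipP] [k kh kE]|[k kh kE]].
- by exists k => //; left.
- by exists k => //; right.
- by case: kE => kE; [left|right]; apply/zipP; exists k.
Qed.

Lemma path_graph_sym h : undirected (path_graph h).
Proof. by move=> x y; rewrite !inE /= orbC. Qed.

Lemma path_graph_connected h : (forall v, v \in h) -> strongly_connected (path_graph h).
Proof.
move=> hV; have sym := undirected_connect_sym _ _ (path_graph_sym h).
suff h0 x : connect (arc_rel (path_graph h)) (nth x0 h 0) x.
  by move=> x y; apply: connect_trans (h0 y); rewrite sym.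
have /nthP - /(_ x0) [k kh <-] := hV x; elim: k kh => [|k IHk] kh //.
apply: connect_trans (IHk (ltnW kh)) (connect1 _).
by apply/path_graphP; exists k => //; left.
Qed.

Lemma path_graph_outdeg h x : uniq h -> (outdeg (path_graph h) x <= 2)%N.
Proof.
move=> Uh; apply: (@leq_trans #|[set nth x0 h (index x h).+1; nth x0 h (index x h).-1]|); last first.
  by rewrite cards2; case: (_ != _).
apply/subset_leq_card/fintype.subsetP => y; rewrite finset.in_set => /path_graphP [k kh].
by case=> -[-> ->]; rewrite !inE index_uniq ?eqxx ?orbT // ltnW.
Qed.

(* On a path every function of the arcs is, up to the variation of a potential, equal to its
   symmetrization; around a circuit the variation of the potential vanishes. *)
Lemma path_graph_potential (R : realFieldType) h (d : V -> V -> R) : uniq h ->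
  exists phi : V -> R, forall x y, (x, y) \in path_graph h ->
    d x y = (d x y + d y x) / 2 + phi y - phi x.
Proof.
move=> Uh; pose v k := nth x0 h k.
(* The antisymmetric part of [d], summed along the path from its start to [x]. *)
exists (fun x => \sum_(k < index x h) (d (v k) (v k.+1) - d (v k.+1) (v k)) / 2).
move=> x y /path_graphP [k kh]; have kh' := ltnW kh.
by case=> -[-> ->]; rewrite !index_uniq // big_ord_recr /= -/(v _) -/(v _); field.
Qed.
End PathGraph.

(** * Bounds on circuit means and cycle times *)

Section Overlays.
Variables (R : realType) (V : finType) (net : network R V).
Implicit Types (E T : {set V * V}) (c h : seq V).

Lemma circuit_arc {E c e} : circuit E c -> e \in zip c (rot 1 c) -> e \in E.
Proof.
case: c => // x p /andP [_ /(pathP x) Ec]; rewrite rot1_cons.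
case/(nthP (x, x)) => k kz <-; have kp : (k < size (x :: p))%N.
  by move: kz; rewrite size_zip /= size_rcons minnn.
have := Ec k; rewrite size_rcons -rcons_cons nth_rcons kp => /(_ isT).
by rewrite nth_zip_cond kz.
Qed.

(** The potential telescopes to zero around a circuit, so it certifies [K] as a bound on the mean
    even when single arcs exceed [K]. *)
Lemma circuit_mean_le (d : V -> V -> R) E (phi : V -> R) (K : R) c :
  (forall x y, (x, y) \in E -> d x y <= K + phi y - phi x) -> circuit E c ->
  (\sum_(e <- zip c (rot 1 c)) d e.1 e.2) / (size c)%:R <= K.
Proof.
move=> dK Ec; have [c0 _] := andP Ec.
have sz : size c = size (rot 1 c) by rewrite size_rot.
rewrite ler_pdivrMr ?ltr0n ?lt0n ?size_eq0 //.
have telescope : \sum_(e <- zip c (rot 1 c)) (K + phi e.2 - phi e.1) = K * (size c)%:R.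
  rewrite sumrB big_split /= -(big_map fst predT phi) -(big_map snd predT phi) -/(unzip1 _) -/(unzip2 _).
  rewrite unzip1_zip ?unzip2_zip -?sz // (perm_big c) /= ?perm_rot //.
  by rewrite addrK big_const_seq count_predT iter_addr_0 size_zip -sz minnn mulr_natr.
rewrite -telescope big_seq [leRHS]big_seq; apply: ler_sum => -[x y] /(circuit_arc Ec); exact: dK.
Qed.

(** Circuits may repeat vertices and so can be infinitely many; [sup] is an upper bound of their
    means only once these are bounded. *)
Lemma circuit_means_bounded E :
  has_ubound [set circuit_delay net E c / (size c)%:R | c in [set c | circuit E c]]%classic.
Proof.
exists (\sum_(e in E) `|overlay_delay net E e.1 e.2|) => _ [c Ec <-].
apply: (@circuit_mean_le _ E (fun=> 0)) => // x y Exy; rewrite addr0 subr0.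
rewrite (bigD1 (x, y)) //=; apply: le_trans (ler_norm _) _.
by rewrite lerDl sumr_ge0.
Qed.

Lemma two_circuit_le_cycle_time E i j : (i, j) \in E -> (j, i) \in E ->
  (overlay_delay net E i j + overlay_delay net E j i) / 2 <= cycle_time net E.
Proof.
move=> Eij Eji; apply: ub_le_sup (circuit_means_bounded E) _ _.
exists [:: i; j]; first by rewrite /= /circuit /= /arc_rel Eij Eji.
by rewrite /circuit_delay /rot /= big_cons big_seq1.
Qed.

Lemma cycle_time_ge0 E : E \subset conn net -> 0 <= cycle_time net E.
Proof.
move=> EC; rewrite /cycle_time; set S := image _ _.
(* Without circuits, as on a single vertex, [sup] takes its default value 0. *)
have [->|] := eqVneq S classical_sets.set0; first by rewrite sup0.
case/set0P => x Sx; apply: le_trans (ub_le_sup (circuit_means_bounded E) Sx).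
case: Sx => c Ec <-; apply: divr_ge0 => //; rewrite /circuit_delay big_seq.
apply: sumr_ge0 => -[i j] /(circuit_arc Ec) /(fintype.subsetP EC) Cij /=.
have [M0 u0 d0 b0] := And4 (msize_gt0 net) (cup_gt0 net i) (cdn_gt0 net j) (bw_gt0 Cij).
rewrite !addr_ge0 ?mulr_ge0 ?tcomp_ge0 ?lat_ge0 ?invr_ge0 ?(ltW M0) //.
by rewrite !le_min !divr_ge0 ?(ltW u0) ?(ltW d0) ?(ltW b0).
Qed.
End Overlays.

(** * Delays limited by the uplinks, and the bound for the Hamiltonian path *)

Section NodeCapacitated.
Variables (R : realType) (V : finType) (net : network R V).
Implicit Types (E T F : {set V * V}) (U : {set V}) (h : seq V).

Local Notation access_delay i := (msize net / cup net i).
Local Notation bw_delay i j := (msize net / bw net i j).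
Local Notation cup_is_small := (forall i j, (i, j) \in conn net ->
  cup net i <= Num.min (cdn net j / #|V|%:R) (bw net i j)).

Lemma conn_neq i j : (i, j) \in conn net -> i != j.
Proof. by move=> Cij; apply: contraTneq Cij => ->; apply: conn_irr. Qed.

Lemma sym_conn_undirected : undirected (sym_conn net).
Proof. by move=> i j; rewrite !inE /= andbC. Qed.

Lemma sym_connE i j : euclidean net -> ((i, j) \in sym_conn net) = (i != j).
Proof.
case=> complete _ _; rewrite inE /=; apply/andP/idP => [[/conn_neq //]|ij].
by split; apply: complete; rewrite // eq_sym.
Qed.

Lemma und_weightC i j : und_weight net i j = und_weight net j i.
Proof. by rewrite /und_weight; ring. Qed.

(** The shared uplink is at most the full one, which is at most the bandwidth and the downlink
    divided by [#|V|]; the in-degree is at most [#|V|]. Hence the uplink attains the minimum. *)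
Lemma overlay_delayE E i j : cup_is_small -> E \subset conn net -> (i, j) \in E ->
  overlay_delay net E i j =
    (nsteps net)%:R * tcomp net i + lat net i j + (outdeg E i)%:R * access_delay i.
Proof.
move=> small EC Eij; have Cij := fintype.subsetP EC _ Eij.
have [M0 u0 d0] := And3 (msize_gt0 net) (cup_gt0 net i) (cdn_gt0 net j).
have o0 : (0 < outdeg E i)%N by apply/card_gt0P; exists j; rewrite inE.
have n0 : (0 < indeg E j)%N by apply/card_gt0P; exists i; rewrite inE.
have N0 : (0 < #|V|)%N by apply/card_gt0P; exists i.
have := small _ _ Cij; rewrite le_min => /andP [ud ub].
have uo : cup net i / (outdeg E i)%:R <= cup net i.
  by rewrite ler_pdivrMr ?ltr0n // ler_peMr ?(ltW u0) // ler1n.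
congr (_ + _); rewrite min_l.
  by field; rewrite (gt_eqF u0) pnatr_eq0 -lt0n o0.
rewrite le_min (le_trans uo ub) andbT; apply: le_trans (le_trans uo ud) _.
by rewrite ler_wpM2l ?(ltW d0) // lef_pV2 ?posrE ?ltr0n // ler_nat max_card.
Qed.

(** [und_weight] is the mean delay of the 2-circuit with both degrees replaced by 1, and degrees at
    the ends of an arc are at least 1. *)
Lemma und_weight_le_cycle_time E i j : cup_is_small ->
  undirected_overlay net E -> (i, j) \in E -> und_weight net i j <= cycle_time net E.
Proof.
move=> small [EC _ symE] Eij; have Eji := symE _ _ Eij.
apply: le_trans (two_circuit_le_cycle_time _ _ _ _ _ _ Eij Eji).
rewrite !overlay_delayE // /und_weight.
have deg1 k l : (k, l) \in E -> access_delay k <= (outdeg E k)%:R * access_delay k.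
  move=> Ekl; rewrite ler_peMl ?divr_ge0 ?(ltW (msize_gt0 _)) ?(ltW (cup_gt0 _ _)) //.
  by rewrite ler1n; apply/card_gt0P; exists l; rewrite inE.
have := deg1 _ _ Eij; have := deg1 _ _ Eji; lra.
Qed.

Lemma tree_weight_add_edge F a b : a != b -> (a, b) \notin F -> (b, a) \notin F ->
  tree_weight net ((a, b) |: ((b, a) |: F)) = tree_weight net F + und_weight net a b.
Proof.
move=> ab Fab Fba; rewrite /tree_weight big_setU1 ?big_setU1 //=; last first.
  by rewrite in_setU1 negb_or Fab andbT; apply: contra_neq ab => -[].
by rewrite [und_weight _ b a]und_weightC; field.
Qed.

(** The connected overlay [E] crosses the cut left by deleting the tree edge. Exchanging that edge
    for a crossing one cannot lower the weight of [T], so the tree edge weighs no more than an edge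
    of [E]. *)
Lemma mst_edge_le_cycle_time T E i j : cup_is_small ->
  minimum_spanning_tree net T -> undirected_overlay net E -> (i, j) \in T ->
  und_weight net i j <= cycle_time net E.
Proof.
move=> small [treeT minT] ovE Tij; have [EC conE symE] := ovE.
have [TC symT _ acT] := treeT; have ij : i != j.
  by have := fintype.subsetP TC _ Tij; rewrite inE => /andP [/conn_neq].
pose F := del_edge _ T i j; pose U := [set x | connect (arc_rel F) i x].
have [a [b []]] : exists a b, [/\ a \in U, b \notin U & arc_rel E a b].
  apply: connect_crossing (conE i j) _ _; rewrite inE ?connect0 //.
  exact: acyclic_del_edge.
rewrite !inE => ia ib Eab; apply: le_trans (und_weight_le_cycle_time E a b small ovE Eab).
have Cab : (a, b) \in sym_conn net.
  by rewrite inE !(fintype.subsetP EC) // symE.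
have symF : undirected F by apply: del_edge_sym.
have FabN : (a, b) \notin F.
  by apply: contra ib => Fab; apply: connect_trans ia (connect1 _).
have FbaN : (b, a) \notin F by apply: contra FabN => /symF.
have ab : a != b by apply: contraNneq ib => <-.
have : tree_weight net T <= tree_weight net ((a, b) |: ((b, a) |: F)).
  by apply: minT; apply: exchange_spanning_tree sym_conn_undirected _ _ _ _ _ _.
have {1}-> : T = (i, j) |: ((j, i) |: F).
  apply/setP => e; rewrite !inE; case: eqP => [-> //|_]; case: eqP => [->|//].
  by rewrite symT.
by rewrite !tree_weight_add_edge ?lerD2l //; rewrite !inE eqxx ?orbT.
Qed.

Lemma bw_delay_le i j : cup_is_small -> (i, j) \in conn net ->
  bw_delay i j <= access_delay i.
Proof.
move=> small Cij; have := small _ _ Cij; rewrite le_min => /andP [_ ub].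
by rewrite ler_wpM2l ?(ltW (msize_gt0 _)) // lef_pV2 ?posrE ?cup_gt0 // bw_gt0.
Qed.

Lemma bw_delay_le_conn_delay i j : (i, j) \in conn net ->
  0 <= bw_delay i j <= conn_delay net i j.
Proof.
move=> Cij; rewrite divr_ge0 ?(ltW (msize_gt0 _)) ?(ltW (bw_gt0 Cij)) //=.
by rewrite lerDr addr_ge0 ?mulr_ge0 ?tcomp_ge0 ?lat_ge0.
Qed.

(* The weight und_weight need not satisfy the triangle inequality, unlike conn_delay;
   the access delays of the ends of a path are charged to its first and last edges. *)
Lemma conn_delay_le_und_weight i j : euclidean net -> cup_is_small -> i != j ->
  [/\ 0 <= conn_delay net i j, conn_delay net i j <= und_weight net i j,
      conn_delay net i j + access_delay i <= 2 * und_weight net i j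
    & conn_delay net i j + access_delay j <= 2 * und_weight net i j].
Proof.
move=> euc small ij; have [complete symd _] := euc.
have [Cij Cji] : (i, j) \in conn net /\ (j, i) \in conn net.
  by split; apply: complete; rewrite // eq_sym.
have := bw_delay_le _ _ small Cij; have := bw_delay_le _ _ small Cji.
have /andP[] := bw_delay_le_conn_delay _ _ Cij; have /andP[] := bw_delay_le_conn_delay _ _ Cji.
have := symd _ _ ij; rewrite /conn_delay /und_weight => *; split; lra.
Qed.

(** On three tree edges the outer two, each with an access delay, cost at most [2 * B] and the
    middle one at most [B]; shorter paths cost at most [4 * B]. *)
Lemma cube_edge_le T (B : R) u v : euclidean net -> cup_is_small ->
  T \subset conn net -> (forall x y, (x, y) \in T -> und_weight net x y <= B) ->
  (u, v) \in cube T ->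
  conn_delay net u v + access_delay u + access_delay v <= 5 * B.
Proof.
move=> euc small TC TB; have [_ _ tri] := euc.
have edge x y : (x, y) \in T -> [/\ x != y, 0 <= conn_delay net x y,
    conn_delay net x y <= B, conn_delay net x y + access_delay x <= 2 * B
    & conn_delay net x y + access_delay y <= 2 * B].
  move=> Txy; have xy := conn_neq _ _ (fintype.subsetP TC _ Txy).
  have [] := conn_delay_le_und_weight _ _ euc small xy; have := TB _ _ Txy.
  by move=> *; split=> //; lra.
have one x y : (x, y) \in T ->
    conn_delay net x y + access_delay x + access_delay y <= 5 * B.
  by move/edge => [] *; lra.
rewrite inE /= => /andP [uv /existsP [[p /= p3]]] /andP [].
case: p p3 => [|w [|z [|t [|? ?]]]] //= _.
- by move=> _ uv'; rewrite uv' in uv.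
- by rewrite andbT => Tuw /eqP <-; apply: one.
- rewrite andbT => /andP [/edge [uw ? ? ? ?] /edge [wz ? ? ? ?]] /eqP zv; rewrite -zv in uv *.
  have := tri _ _ _ uv uw wz; lra.
- rewrite andbT => /and3P [Tuw /edge [wz ? ? ? ?] /edge [zt ? ? ? ?]] /eqP tv; rewrite -tv in uv *.
  (* The walk may backtrack; then [u] and [t] are joined by a tree edge, and the triangle inequality
     for distinct nodes is not invoked. *)
  have [wt|wt] := eqVneq w t; first by rewrite -wt; apply: one.
  have [uw ? ? ? ?] := edge _ _ Tuw.
  have := tri _ _ _ uv uw wt; have := tri _ _ _ wt wz zt; lra.
Qed.

Lemma path_graph_overlay T h : euclidean net -> undirected T ->
  hamiltonian_path (cube T) h -> undirected_overlay net (path_graph h).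
Proof.
move=> euc symT [_ hV hT]; split; last exact: path_graph_sym.
  have [complete _ _] := euc; apply/fintype.subsetP => -[x y].
  have [x0 _] : exists x0, x0 == x by exists x.
  case/(path_graphP _ x0) => k kh; have /(sortedP x0) /(_ k kh) := hT; rewrite /arc_rel inE /= => /andP [ne _].
  by case=> -[-> ->]; apply: complete => //; rewrite eq_sym.
by move=> x; apply: path_graph_connected.
Qed.

Lemma path_graph_cycle_time T h E : euclidean net -> cup_is_small ->
  minimum_spanning_tree net T -> hamiltonian_path (cube T) h -> undirected_overlay net E ->
  cycle_time net (path_graph h) <= 6 * cycle_time net E.
Proof.
move=> euc small mstT hamh ovE; have [[TC symT _ _] _] := mstT.
have B0 : 0 <= cycle_time net E by apply: cycle_time_ge0; case: ovE.
have [Uh hV hT] := hamh; have [HC _ symH] := path_graph_overlay _ _ euc symT hamh.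
rewrite {1}/cycle_time; set S := image _ _.
have [->|/set0P S0] := eqVneq S classical_sets.set0; first by rewrite sup0 mulr_ge0.
apply: ge_sup => // _ [c Hc <-].
have [x0 _] : exists x0, x0 \in c by case: c Hc => // x c _; exists x; rewrite mem_head.
have [phi phiE] := path_graph_potential _ x0 _ _ (overlay_delay net (path_graph h)) Uh.
apply: (circuit_mean_le _ _ _ _ phi _ _ _ Hc) => x y Hxy; rewrite phiE // !lerD2r.
have TB i j := mst_edge_le_cycle_time _ _ i j small mstT ovE.
have TC' : T \subset conn net.
  by apply: fintype.subset_trans TC _; apply/fintype.subsetP => e; rewrite inE => /andP [].
have Hyx := symH _ _ Hxy; rewrite !overlay_delayE //.
have deg2 k : (outdeg (path_graph h) k)%:R * access_delay k <= 2 * access_delay k.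
  rewrite ler_wpM2r ?divr_ge0 ?(ltW (msize_gt0 _)) ?(ltW (cup_gt0 _ _)) //.
  by rewrite ler_nat path_graph_outdeg.
have := deg2 x; have := deg2 y.
have [Cxy Cyx] := (fintype.subsetP HC _ Hxy, fintype.subsetP HC _ Hyx).
have /andP [+ _] := bw_delay_le_conn_delay _ _ Cxy.
have /andP [+ _] := bw_delay_le_conn_delay _ _ Cyx.
have [_ symd _] := euc; have := symd _ _ (conn_neq _ _ Cxy).
(* The cube arc is known in the direction in which [h] runs; the symmetry of [conn_delay] covers the
   other one. *)
have : conn_delay net x y + access_delay x + access_delay y <= 5 * cycle_time net E \/
       conn_delay net y x + access_delay y + access_delay x <= 5 * cycle_time net E.
  move: Hxy => /(path_graphP _ x0) [k kh].
  have /(sortedP x0) /(_ k kh) := hT => cuk.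
  by case=> -[-> ->]; [left|right]; apply: cube_edge_le cuk.
(* Dropping the nonnegative bandwidth delays leaves a mean of at most 5 times the cycle time of [E];
   [B0] relaxes 5 to 6. *)
by rewrite /conn_delay => -[] *; lra.
Qed.

End NodeCapacitated.

(** * Correctness and progress of the degree-bounded Prim procedure *)

Section Prim.
Variables (R : realType) (V : finType) (net : network R V).
Implicit Types (E T : {set V * V}) (U : {set V}).

Lemma prim_run_tree delta U T : prim_run net delta U T ->
  [/\ T \subset sym_conn net, undirected T,
      forall x y, (x, y) \in T -> x \in U
    & forall x y, x \in U -> y \in U -> connect (arc_rel T) x y].
Proof.
elim=> {U T} [v|U T u v _ [TC symT TU conU] /and4P [Cuv uU vU _] _].
  split=> [||x y|x y]; first exact: finset.sub0set.
  - by move=> x y; rewrite finset.in_set0.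
  - by rewrite finset.in_set0.
  - by rewrite !finset.in_set1 => /eqP-> /eqP->.
set T' := _ |: _.
have symT' : undirected T'.
  move=> x y; rewrite !in_setU1 !xpair_eqE => /or3P [/andP[/eqP-> /eqP->]|/andP[/eqP-> /eqP->]|/symT->].
  - by rewrite !eqxx orbT.
  - by rewrite !eqxx.
  - by rewrite !orbT.
split=> //.
- apply/fintype.subsetP => e; rewrite !in_setU1 => /or3P [/eqP->|/eqP->|] //.
    exact: sym_conn_undirected.
  exact: fintype.subsetP TC e.
- by move=> x y; rewrite !in_setU1 => /or3P [/eqP[-> _]|/eqP[-> _]|/TU->];
    rewrite ?uU ?eqxx ?orbT.
- suff uT' x : x \in v |: U -> connect (arc_rel T') u x.
    move=> x y /uT' ux /uT'; apply: connect_trans.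
    by rewrite undirected_connect_sym.
  rewrite in_setU1 => /predU1P [->|xU]; first by apply: connect1; rewrite /arc_rel !inE eqxx.
  apply: connect_sub (conU _ _ uU xU) => a b Tab; apply: connect1.
  by rewrite /arc_rel !in_setU1 [_ \in T]Tab !orbT.
Qed.

Lemma prim_run_overlay delta T : prim_run net delta [set: V] T -> undirected_overlay net T.
Proof.
case/prim_run_tree => TC symT _ conT; split=> //.
  by apply: fintype.subset_trans TC _; apply/fintype.subsetP => e; rewrite inE => /andP [].
by move=> x y; apply: conT; rewrite inE.
Qed.

(* The procedure is never stuck: the last added vertex is a leaf. *)
Lemma prim_run_exists delta : euclidean net -> (1 < delta)%N -> (0 < #|V|)%N ->
  exists T, prim_run net delta [set: V] T.
Proof.
move=> euc delta1 V0.
suff run k : (k < #|V|)%N -> exists U T v,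
    [/\ prim_run net delta U T, #|U| = k.+1, v \in U & (outdeg T v < delta)%N].
  have [] := run #|V|.-1; first by rewrite prednK.
  move=> U [T [_ [runT + _ _]]]; rewrite prednK // => cardU; exists T.
  by have -> : [set: V] = U by apply/esym/eqP; rewrite eqEcard finset.subsetT cardsT cardU leqnn.
elim: k => [|k IHk] kV.
  have /card_gt0P [v _] := V0; exists [set v], finset.set0, v; split.
  - exact: prim_start.
  - exact: cards1.
  - exact: set11.
  - by rewrite /outdeg (_ : [set j | _] = finset.set0) ?cards0 ?(ltnW delta1) //;
      apply/setP => j; rewrite !inE.
have [U [T [u [runT cardU uU degu]]]] := IHk (ltnW kV).
have [w wU] : exists w, w \notin U.
  apply/existsP; apply: contraTT kV; rewrite negb_exists => /forallP UV.
  rewrite -leqNgt -cardU subset_leq_card //; apply/fintype.subsetP => x _.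
  by have := UV x; rewrite negbK.
have cuw : prim_candidate net delta U T u w.
  by rewrite /prim_candidate sym_connE // uU wU degu /= andbT; apply: contraNneq wU => <-.
pose cand (e : V * V) := prim_candidate net delta U T e.1 e.2.
have := @arg_minP _ _ _ (u, w) cand (fun e => und_weight net e.1 e.2) cuw.
case=> -[a b] cab minab; rewrite /cand /= in cab minab.
have [_ _ TU _] := prim_run_tree _ _ _ runT.
have [_ aU bU _] := and4P cab.
exists (b |: U), ((a, b) |: ((b, a) |: T)), b; split.
- by apply: prim_step runT cab _ => u' v' c'; apply: (minab (u', v')).
- by rewrite cardsU1 bU cardU.
- by rewrite !inE eqxx.
(* No arc of [T] starts at [b], so [a] is its only neighbour in the new tree. *)
- apply: leq_ltn_trans delta1; rewrite -(cards1 a); apply/subset_leq_card/fintype.subsetP => j.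
  rewrite !inE !xpair_eqE eqxx /= => /or3P [/andP [/eqP ba _]|//|/TU bU'].
    by rewrite ba aU in bU.
  by rewrite bU' in bU.
Qed.
End Prim.

(** * Existence of an output and the approximation ratio *)

Lemma minimum_spanning_tree_exists (R : realType) (V : finType) (net : network R V) :
  euclidean net -> exists T, minimum_spanning_tree net T.
Proof.
move=> euc; have [|T0 treeT0] := @star_spanning_tree V (sym_conn net) (sym_conn_undirected _ _ net).
  have [r _|V0] := pickP [pred x : V | true]; [left|right; exact: eq_card0].
  by exists r => x xr; rewrite sym_connE // eq_sym.
have /asboolP T0P := treeT0.
have := @arg_minP _ _ _ T0 (fun T => `[< spanning_tree (sym_conn net) T >]) (tree_weight net) T0P.
by case=> T /asboolP treeT minT; exists T; split=> // T' /asboolP; apply: minT.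
Qed.

Theorem proposition3p5 (R : realType) (V : finType) (net : network R V)
  (net_euclidean : euclidean net)
  (cup_small : forall i j, (i, j) \in conn net ->
     cup net i <= Num.min (cdn net j / #|V|%:R) (bw net i j)) :
  (exists E : {set V * V}, algorithm_output net E) /\
  (forall E : {set V * V}, algorithm_output net E ->
     undirected_overlay net E /\ cycle_time net E <= 6 * opt_cycle_time net).
Proof.
split=> [|E [T [h [P [mstT hamh runP /= [ES minE]]]]]].
  have [T mstT] := minimum_spanning_tree_exists _ _ net net_euclidean.
  have [[_ symT conT _] _] := mstT; have [h hamh] := cube_hamiltonian_path _ _ symT conT.
  have /choice [P runP] : forall delta, exists Pd, (3 <= delta <= #|V|)%N ->
      prim_run net delta [set: V] Pd.
    move=> delta; have [/andP [d3 dV]|_] := boolP (3 <= delta <= #|V|)%N; last first.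
      by exists finset.set0.
    have [] := prim_run_exists _ _ net delta net_euclidean; first exact: leq_trans d3.
      by apply: leq_trans dV; apply: leq_trans d3.
    by move=> Pd; exists Pd.
  pose S := path_graph h :: [seq P delta | delta <- index_iota 3 #|V|.+1].
  have S0 : path_graph h \in S by rewrite mem_head.
  have [E ES minE] := @arg_minP _ _ _ (path_graph h) (mem S) (cycle_time net) S0.
  by exists E, T, h, P; split.
have [[_ symT conT _] _] := mstT.
have ovE : undirected_overlay net E.
  move: ES; rewrite in_cons => /predU1P [->|/mapP [delta + ->]].
    exact: path_graph_overlay hamh.
  by rewrite mem_index_iota ltnS => /runP /prim_run_overlay.
(* A sixth of the output's cycle time is a lower bound for all overlays, a nonempty set since it
   contains [E]; the output is no worse than the Hamiltonian path. *)
split=> //; rewrite mulrC -ler_pdivrMr //; apply: lb_le_inf.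
  by exists (cycle_time net E), E.
move=> _ [E' ovE' <-]; rewrite ler_pdivrMr // mulrC.
by apply: le_trans (minE _ (mem_head _ _)) _; apply: path_graph_cycle_time hamh ovE'.
Qed.
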